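(* Let $\mathcal T$ be a set of tile designs for the cube with symmetry group the full octahedral group $O_h$ (order $48$). Suppose there are $t_{\mathrm{id}}$ tiles, of which $t_r$ are fixed under $90^\circ$ rotation, $t_{r^2}$ are fixed under $180^\circ$ rotation, $t_f$ are fixed under horizontal reflection, and $t_{rf}$ are fixed under diagonal reflection of the square face. Then the number of ways of tiling the faces of the cube up to full octahedral symmetry $O_h$ is $$\frac{1}{48}\left(t_{\mathrm{id}}^6+6t_{\mathrm{id}}t_r^2+3t_{\mathrm{id}}^2t_{r^2}^2+8t_{\mathrm{id}}^2+6t_{\mathrm{id}}^3+t_{\mathrm{id}}^3+6t_{\mathrm{id}}t_{r^2}+3t_{\mathrm{id}}t_f^4+8t_{\mathrm{id}}+6t_{\mathrm{id}}^2t_{rf}^2\right)$$ $$=\frac{1}{48}\left(t_{\mathrm{id}}^6+7t_{\mathrm{id}}^3+8t_{\mathrm{id}}^2+8t_{\mathrm{id}}+6t_{\mathrm{id}}t_r^2+6t_{\mathrm{id}}t_{r^2}+3t_{\mathrm{id}}^2t_{r^2}^2+3t_{\mathrm{id}}t_f^4+6t_{\mathrm{id}}^2t_{rf}^2\right).$$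
   Context: Tilings. Let $P$ be a polyhedron with set of faces $\mathcal F$ and let $\mathcal A$ be a group of isometries of $P$, acting on $\mathcal F$. A set of tile designs is a finite set $\mathcal T$ together with a group action of $\mathcal A$ on $\mathcal T\times\mathcal F$ lying over the action on $\mathcal F$ (so $A\cdot(T,F)=(T',A\cdot F)$ for some $T'\in\mathcal T$). A tiling is a map $\tau:\mathcal F\to\mathcal T$; $\mathcal A$ acts on tilings by moving graphs: $A\cdot\tau$ is the tiling with $((A\cdot\tau)(A\cdot F),A\cdot F)=A\cdot(\tau(F),F)$ for all $F$. The number of ways of tiling up to $\mathcal A$ is the number of $\mathcal A$-orbits on the set of tilings. The induced symmetry group $G$ of a face $F$ is the group of isometries of $F$ realized by elements of the stabilizer $\mathcal A_F$; for $g\in G$, $t_g$ is the number of $T\in\mathcal T$ with $g\cdot(T,F)=(T,F)$, where $g$ acts via the element of $\mathcal A_F$ inducing it. Since $\mathcal A$ acts transitively on faces, $t_g$ does not depend on the choice of $F$. In particular $t_{\mathrm{id}}=|\mathcal T|$. Polyhedron and group. Here $\mathcal A=O_h$ is the group of order $48$ of all $3\times3$ signed permutation matrices. The cube is the convex hull of the $O_h$-orbit of $(1,1,1)$ ($8$ vertices, $6$ square faces). The induced symmetry group of a face is $D_4=\langle r,f\mid r^4=f^2=(rf)^2=e\rangle$, with $r$ a $90^\circ$ rotation, $f$ a non-diagonal reflection of the square, and $rf$ a diagonal reflection. *)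

(* Defs.v *)
From HB Require Import structures.
From mathcomp Require Import all_boot all_order all_algebra all_fingroup.
From mathcomp Require Import boolp classical_sets reals.

Set Implicit Arguments.
Unset Strict Implicit.
Unset Printing Implicit Defensive.

Import Order.TTheory GRing.Theory Num.Theory.

Local Open Scope ring_scope.

(* Points are row vectors and matrices act on the right, x |-> x *m A, so that
   every group action below is a right action in the sense of the library.
   Transposition is an anti-automorphism of the group of signed permutation
   matrices, hence this is equivalent to letting it act on the left on column
   vectors. *)

Section SignedPermutationMatrices.
Variables (R : realType) (n : nat).
Implicit Types (s : 'S_n) (e : {ffun 'I_n -> bool}) (A B : 'M[R]_n).

Definition signed_perm_mx s e : 'M[R]_n :=
  \matrix_(i, j) ((-1) ^+ e i *+ (s i == j)).

Definition is_signed_perm A :=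
  [exists s : 'S_n, exists e : {ffun 'I_n -> bool}, A == signed_perm_mx s e].

Lemma is_signed_permP A :
  reflect (exists s e, A = signed_perm_mx s e) (is_signed_perm A).
Proof.
apply: (iffP existsP) => [[s /existsP[e /eqP->]]|[s [e ->]]]; first by exists s, e.
by exists s; apply/existsP; exists e.
Qed.

Lemma mul_signed_perm_mx s e s' e' :
  signed_perm_mx s e *m signed_perm_mx s' e' =
  signed_perm_mx (s * s')%g [ffun i => e i (+) e' (s i)].
Proof.
apply/matrixP=> i j; rewrite !mxE (bigD1 (s i)) //= big1 => [|k kNsi].
  by rewrite !mxE eqxx mulr1n addr0 permM ffunE signr_addb mulrnAr.
by rewrite !mxE eq_sym (negPf kNsi) mulr0n mul0r.
Qed.

Lemma signed_perm_mx1 : signed_perm_mx 1%g [ffun=> false] = 1%:M.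
Proof. by apply/matrixP=> i j; rewrite !mxE perm1 ffunE. Qed.

Lemma tr_signed_perm_mx s e :
  (signed_perm_mx s e)^T = signed_perm_mx s^-1%g [ffun i => e (s^-1%g i)].
Proof.
apply/matrixP=> i j; rewrite !mxE ffunE.
have [<-|sjNi] := eqVneq (s j) i; first by rewrite permK eqxx.
have [ij|//] := eqVneq; first by rewrite -ij permKV eqxx in sjNi.
Qed.

Lemma is_signed_perm1 : is_signed_perm 1%:M.
Proof. by apply/is_signed_permP; exists 1%g, [ffun=> false]; rewrite signed_perm_mx1. Qed.

Lemma is_signed_permM A B :
  is_signed_perm A -> is_signed_perm B -> is_signed_perm (A *m B).
Proof.
move=> /is_signed_permP[s [e ->]] /is_signed_permP[s' [e' ->]].
by apply/is_signed_permP; rewrite mul_signed_perm_mx; do 2!eexists.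
Qed.

Lemma is_signed_perm_tr A : is_signed_perm A -> is_signed_perm A^T.
Proof.
move=> /is_signed_permP[s [e ->]]; rewrite tr_signed_perm_mx.
by apply/is_signed_permP; do 2!eexists.
Qed.

Lemma signed_perm_mulVmx A : is_signed_perm A -> A^T *m A = 1%:M.
Proof.
move=> /is_signed_permP[s [e ->]]; rewrite tr_signed_perm_mx mul_signed_perm_mx.
rewrite -signed_perm_mx1 mulVg; congr signed_perm_mx.
by apply/ffunP=> i; rewrite !ffunE addbb.
Qed.

Lemma signed_perm_mulmxV A : is_signed_perm A -> A *m A^T = 1%:M.
Proof. by move/signed_perm_mulVmx/mulmx1C. Qed.

End SignedPermutationMatrices.

Section OctahedralGroup.
Variable R : realType.

Record Oh := MkOh { Oh_mx :> 'M[R]_3 ; Oh_mxP : is_signed_perm Oh_mx }.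

HB.instance Definition _ := [isSub for Oh_mx].
HB.instance Definition _ := [Choice of Oh by <:].

Definition Oh_of (p : 'S_3 * {ffun 'I_3 -> bool}) : option Oh :=
  insub (signed_perm_mx R p.1 p.2).
Definition Oh_code (A : Oh) : 'S_3 * {ffun 'I_3 -> bool} :=
  odflt (1%g, [ffun=> false])
    [pick p | Oh_mx A == signed_perm_mx R p.1 p.2].

Lemma Oh_codeK : pcancel Oh_code Oh_of.
Proof.
move=> A; rewrite /Oh_code; case: pickP => [p /eqP Ap|noA].
  by rewrite /Oh_of -Ap; apply: valK.
by case/is_signed_permP: (Oh_mxP A) => s [e Ase]; move: (noA (s, e)); rewrite Ase eqxx.
Qed.

HB.instance Definition _ : isCountable Oh := PCanIsCountable Oh_codeK.
HB.instance Definition _ : isFinite Oh := PCanIsFinite Oh_codeK.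

Definition Oh_one : Oh := MkOh (is_signed_perm1 R 3).
Definition Oh_mul (A B : Oh) : Oh := MkOh (is_signed_permM (Oh_mxP A) (Oh_mxP B)).
Definition Oh_inv (A : Oh) : Oh := MkOh (is_signed_perm_tr (Oh_mxP A)).

Lemma Oh_mulA : associative Oh_mul.
Proof. by move=> A B C; apply: val_inj; rewrite /= mulmxA. Qed.
Lemma Oh_mul1 : left_id Oh_one Oh_mul.
Proof. by move=> A; apply: val_inj; rewrite /= mul1mx. Qed.
Lemma Oh_mulV : left_inverse Oh_one Oh_inv Oh_mul.
Proof. by move=> A; apply: val_inj; rewrite /= (signed_perm_mulVmx (Oh_mxP A)). Qed.

HB.instance Definition _ := Finite_isGroup.Build Oh Oh_mulA Oh_mul1 Oh_mulV.

Lemma Oh_mx1 : Oh_mx 1%g = 1%:M. Proof. by []. Qed.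
Lemma Oh_mxM (A B : Oh) : Oh_mx (A * B)%g = Oh_mx A *m Oh_mx B.
Proof. by []. Qed.
Lemma Oh_mxV (A : Oh) : Oh_mx A^-1%g = (Oh_mx A)^T. Proof. by []. Qed.

End OctahedralGroup.

Section Polyhedra.
Variables (R : realType) (n : nat).
Implicit Types (x u : 'rV[R]_n) (P F V : set 'rV[R]_n).
Local Open Scope classical_set_scope.

Definition dot x u : R := (x *m u^T) 0 0.

Definition convex_hull V : set 'rV[R]_n :=
  [set x | exists m (p : 'I_m -> 'rV[R]_n) (w : 'I_m -> R),
     [/\ forall i, V (p i), forall i, 0 <= w i, \sum_i w i = 1
       & x = \sum_i w i *: p i]].

(* Faces of a polyhedron are its two-dimensional faces: the intersections with
   a supporting plane that contain three non-collinear points. *)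
Definition is_face P F :=
  exists u c,
    [/\ u != 0, forall x, P x -> dot x u <= c,
        F = P `&` [set x | dot x u = c]
      & exists p q s, [/\ F p, F q, F s & row_free (col_mx (q - p) (s - p))]].

End Polyhedra.

Section Cube.
Variable R : realType.
Implicit Types (A B : Oh R).
Local Open Scope classical_set_scope.

Definition cube_vertices : set 'rV[R]_3 := range (fun A : Oh R => const_mx 1 *m A).
Definition cube : set 'rV[R]_3 := convex_hull cube_vertices.

Record face := MkFace { face_set :> set 'rV[R]_3 ; faceP : `[< is_face cube face_set >] }.

HB.instance Definition _ := [isSub for face_set].
HB.instance Definition _ := [Choice of face by <:].

Lemma dotE (x u : 'rV[R]_3) : dot x u = \sum_i x 0 i * u 0 i.
Proof. by rewrite /dot mxE; apply: eq_bigr => i _; rewrite mxE. Qed.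

Lemma dot_Oh A (x u : 'rV[R]_3) : dot (x *m A) (u *m A) = dot x u.
Proof.
by rewrite /dot trmx_mul mulmxA -(mulmxA x) (signed_perm_mulmxV (Oh_mxP A)) mulmx1.
Qed.

Lemma cube_Oh A x : cube x -> cube (x *m A).
Proof.
move=> [m [p [w [pV w0 w1 ->]]]].
exists m, (fun i => p i *m A), w; split => // [i|].
  by have [B _ <-] := pV i; exists (B * A)%g; rewrite // Oh_mxM mulmxA.
by rewrite mulmx_suml; apply: eq_bigr => i _; rewrite scalemxAl.
Qed.

Lemma is_face_Oh (F : set 'rV[R]_3) A :
  is_face cube F -> is_face cube [set x *m A | x in F].
Proof.
have AK (x : 'rV[R]_3) : x *m A *m A^-1%g = x.
  by rewrite -mulmxA Oh_mxV (signed_perm_mulmxV (Oh_mxP A)) mulmx1.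
have AVK (x : 'rV[R]_3) : x *m A^-1%g *m A = x.
  by rewrite -mulmxA Oh_mxV (signed_perm_mulVmx (Oh_mxP A)) mulmx1.
move=> [u [c [u0 Pc FE [p [q [s [Fp Fq Fs free]]]]]]].
exists (u *m A), c; split.
- by apply: contra_neq u0 => uA0; rewrite -(AK u) uA0 mul0mx.
- by move=> x /(cube_Oh A^-1%g)/Pc; rewrite -[in dot x _](AVK x) dot_Oh.
- rewrite FE; apply/seteqP; split=> [_ [x [Px xc] <-]|x [Px xc]].
    by split; [apply: cube_Oh | rewrite /= dot_Oh].
  exists (x *m A^-1%g) => //; split; first exact: cube_Oh.
  by rewrite /= -(dot_Oh A) AVK.
exists (p *m A), (q *m A), (s *m A); split; [by exists p|by exists q|by exists s|].
rewrite -!mulmxBl -mul_col_mx /row_free mxrankMfree //.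
by rewrite row_free_unit; case/mulmx1_unit: (signed_perm_mulmxV (Oh_mxP A)).
Qed.

Lemma cube_coord x i : cube x -> `|x 0 i| <= 1.
Proof.
move=> [m [p [w [pV w0 w1 ->]]]]; rewrite summxE (le_trans (ler_norm_sum _ _ _)) //.
rewrite -w1 ler_sum // => k _; rewrite mxE normrM (ger0_norm (w0 k)) ler_piMr //.
have [A _ <-] := pV k; have /is_signed_permP[s [e ->]] := Oh_mxP A.
rewrite mxE (bigD1 (s^-1%g i)) //= big1 => [|j jNi]; last first.
  rewrite !mxE; case: eqP => [sji|_]; last by rewrite mulr0n mulr0.
  by rewrite -sji permK eqxx in jNi.
by rewrite !mxE permKV eqxx mul1r addr0 mulr1n normrX normrN1 expr1n.
Qed.

Lemma cube_vertex (b : 'I_3 -> bool) : cube (\row_i (-1) ^+ b i).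
Proof.
exists 1%N, (fun=> \row_i (-1) ^+ b i), (fun=> 1); split; rewrite ?big_ord1 ?scale1r //.
move=> _.
have sP : is_signed_perm (signed_perm_mx R 1%g (finfun b)).
  by apply/is_signed_permP; do 2!eexists.
exists (MkOh sP) => //; apply/rowP=> i; rewrite !mxE (bigD1 i) //= big1 => [|j jNi].
  by rewrite !mxE perm1 eqxx mul1r addr0 ffunE.
by rewrite !mxE perm1 (negPf jNi) mulr0.
Qed.

Lemma is_face_cube (F : set 'rV[R]_3) : is_face cube F ->
  exists i b, F = cube `&` [set x | x 0 i = (-1) ^+ (b : bool)].
Proof.
move=> [u [c [u0 Pc FE [p [q [s [Fp Fq Fs free]]]]]]].
have Fsg x i : F x -> u 0 i != 0 -> x 0 i = (-1) ^+ (u 0 i < 0)%R.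
  rewrite FE => -[Px xc] ui0.
  have le_xu j : x 0 j * u 0 j <= `|u 0 j|.
    apply: le_trans (ler_norm _) _; rewrite normrM ler_piMl //.
    exact: cube_coord.
  have /Pc := cube_vertex (fun j => u 0 j < 0).
  rewrite -xc !dotE => le_sum.
  have eq_sum : \sum_j (`|u 0 j| - x 0 j * u 0 j) = 0.
    apply/le_anti/andP; split; last by apply: sumr_ge0 => j _; rewrite subr_ge0.
    rewrite sumrB subr_le0 (le_trans _ le_sum) // ler_sum // => j _.
    by rewrite mxE -normrEsign.
  have /eqP := eq_sum; rewrite psumr_eq0 => [/allP/(_ i)|j _]; last by rewrite subr_ge0.
  rewrite mem_index_enum => /(_ isT); rewrite subr_eq0 normrEsign => /eqP/(mulIf ui0).
  by move->.
have [i ui0] : exists i, u 0 i != 0.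
  apply/existsP; apply: contraR u0 => /existsPn u0.
  by apply/eqP/rowP=> i; rewrite mxE; apply/eqP/negPn/u0.
exists i, (u 0 i < 0).
have uj0 j : j != i -> u 0 j = 0.
  move=> jNi; apply/eqP/negPn/negP => uj0.
  have pqs k l : k = i \/ k = j -> col_mx (q - p) (s - p) l k = 0.
    move=> kij; have uk0 : u 0 k != 0 by case: kij => ->.
    have Fk x : F x -> x 0 k = p 0 k by move=> Fx; rewrite (Fsg x) // (Fsg p).
    by rewrite mxE; case: split => l'; rewrite ord1 !mxE Fk ?subrr.
  have /cards1P[k kE] : #|~: [set i; j]%SET| == 1%N.
    by rewrite cardsCs finset.setCK cards2 (eq_sym i) jNi card_ord.
  have Mk : col_mx (q - p) (s - p) = col k (col_mx (q - p) (s - p)) *m delta_mx 0 k.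
    apply/matrixP=> l m; rewrite [RHS]mxE big_ord1 [col _ _ _ _]mxE [delta_mx _ _ _ _]mxE eqxx.
    have [->|mk] := eqVneq m k; first by rewrite mulr1.
    rewrite mulr0 pqs //.
    have : m \notin ~: [set i; j]%SET by rewrite kE inE.
    by rewrite !inE negbK => /orP[]/eqP->; [left|right].
  move: free; rewrite /row_free Mk => /eqP rk2.
  by have := mulmx_max_rank (col k (col_mx (q - p) (s - p))) (delta_mx 0 k); rewrite rk2.
have dotu x : dot x u = x 0 i * u 0 i.
  by rewrite dotE (bigD1 i) //= big1 ?addr0 // => j /uj0 ->; rewrite mulr0.
have [_ pc] : (cube `&` [set x | dot x u = c]) p by rewrite -FE.
apply/seteqP; split=> [x Fx|x [Px xi]]; first by split; [move: Fx; rewrite FE; case | exact: Fsg].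
by rewrite FE; split; rewrite //= dotu xi -(Fsg _ _ Fp ui0) -dotu.
Qed.

Definition face_of (p : 'I_3 * bool) : option face :=
  insub (cube `&` [set x | x 0 p.1 = (-1) ^+ p.2]).
Definition face_code (F : face) : 'I_3 * bool :=
  odflt (ord0, false)
    [pick p : 'I_3 * bool | `[< face_set F = cube `&` [set x | x 0 p.1 = (-1) ^+ p.2] >]].

Lemma face_codeK : pcancel face_code face_of.
Proof.
move=> F; rewrite /face_code; case: pickP => [p /asboolP Fp|noF].
  by rewrite /face_of -Fp; apply: valK.
have [i [b Fib]] := is_face_cube (asboolW (faceP F)).
by move: (noF (i, b)) => /asboolP.
Qed.

HB.instance Definition _ : isCountable face := PCanIsCountable face_codeK.
HB.instance Definition _ : isFinite face := PCanIsFinite face_codeK.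

Definition move_face (F : face) A : face :=
  MkFace (asboolT (is_face_Oh A (asboolW (faceP F)))).

Lemma move_face1 : move_face^~ 1%g =1 id.
Proof.
move=> F; apply: val_inj; apply/seteqP; split=> [_ [x Fx <-]|x Fx].
  by rewrite [_ *m _](mulmx1 x).
by exists x; rewrite // [LHS](mulmx1 x).
Qed.

Lemma move_faceM F : act_morph move_face F.
Proof.
move=> A B; apply: val_inj; apply/seteqP; split=> /=.
  by move=> _ [x Fx <-]; exists (x *m A); [exists x | rewrite -mulmxA].
by move=> _ [_ [x Fx <-] <-]; exists x => //; apply: mulmxA.
Qed.

Canonical face_action := TotalAction move_face1 move_faceM.

End Cube.

Section Tilings.
Variables (aT : finGroupType) (F T : finType) (toF : {action aT &-> F}).

Record tile_designs := TileDesigns {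
  design_action :> {action aT &-> T * F};
  design_action2 : forall p g, (design_action p g).2 = toF p.2 g
}.

Variable D : tile_designs.
Implicit Types (tau : {ffun F -> T}) (g : aT) (S : F).

Definition move_tiling tau g : {ffun F -> T} :=
  [ffun S => (D (tau (toF S g^-1%g), toF S g^-1%g) g).1].

Lemma move_tilingE tau g S :
  (move_tiling tau g (toF S g), toF S g) = D (tau S, S) g.
Proof.
by rewrite ffunE actK [RHS]surjective_pairing design_action2.
Qed.

Lemma move_tilingP tau tau' g :
  (forall S, (tau' (toF S g), toF S g) = D (tau S, S) g) -> tau' = move_tiling tau g.
Proof.
move=> tau'E; apply/ffunP=> S; rewrite -(actKV toF g S).
by have := tau'E (toF S g^-1%g); rewrite -move_tilingE => -[].
Qed.

Lemma move_tiling1 : move_tiling^~ 1%g =1 id.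
Proof. by move=> tau; apply/esym/move_tilingP=> S; rewrite !act1. Qed.

Lemma move_tilingM tau : act_morph move_tiling tau.
Proof.
move=> g h; apply/esym/move_tilingP=> S.
by rewrite !actM !move_tilingE.
Qed.

Canonical tiling_action := TotalAction move_tiling1 move_tilingM.

Definition num_tilings := #|orbit tiling_action [set: aT] @: [set: {ffun F -> T}]|.

Definition num_fixed S g := #|[set t : T | D (t, S) g == (t, S)]|.

End Tilings.

Section FaceSymmetries.
Variable R : realType.
Implicit Types (F : face R) (A : Oh R) (c u v : 'rV[R]_3).

(* (c, u, v) is an orthonormal coordinate system of the plane of F. *)
Definition face_frame F c u v :=
  [/\ dot u u = 1, dot v v = 1, dot u v = 0
    & forall x, face_set F x -> exists a b, x = c + a *: u + b *: v].

Definition quarter_turn F A :=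
  A \in 'C[F | face_action R]%g /\
  exists c u v, face_frame F c u v /\
    forall a b, face_set F (c + a *: u + b *: v) ->
      (c + a *: u + b *: v) *m A = c - b *: u + a *: v.

(* Composed with a quarter turn of F it gives a diagonal reflection.
   The mirror of the reflection is the line through c directed by u; it is a
   diagonal of the square exactly when it contains a vertex. *)
Definition nondiagonal_reflection F A :=
  A \in 'C[F | face_action R]%g /\
  exists c u v, [/\ face_frame F c u v,
    forall a b, face_set F (c + a *: u + b *: v) ->
      (c + a *: u + b *: v) *m A = c + a *: u - b *: v
    & forall x, cube_vertices x -> face_set F x -> ~ exists a, x = c + a *: u].

End FaceSymmetries.

(* Main.v *)
Require Import Defs.
From mathcomp Require Import all_boot all_order all_algebra all_fingroup reals.
From mathcomp Require Import ring.

Set Implicit Arguments.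
Unset Strict Implicit.
Unset Printing Implicit Defensive.

Import Order.TTheory GRing.Theory Num.Theory.

(** By Burnside's lemma, 48 times the number of tilings up to symmetry is the sum
    over g in O_h of the number of tilings fixed by g ([num_tilings_Burnside]).

    A tiling fixed by g is determined by its values on one face S in each cycle
    of g on the faces, and the value at S is constrained only by the return map:
    if the cycle of S has length n, the tile at S must be fixed by g^n.  Hence the
    number of tilings fixed by g is the product over its cycles of
    [num_fixed D S (g ^+ n)] ([card_fixed_tilings]).

    The number [num_fixed D S h] is invariant under simultaneous conjugation of S
    and h, so only the class of h in the dihedral stabilizer of S matters.  Two
    homomorphisms almost separate the classes: writing h as sign changes followed
    by a permutation of the axes, these are the permutation itself and the parity
    of the number of sign changes.  On the stabilizer of a face they induce its
    abelianization, so they determine the class of h except that the identity and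
    the half turn share the trivial value; testing whether h = 1 tells these apart
    ([symmetry_of], [num_fixed_symmetry]).  The geometric hypotheses on r and f
    are used only to find their classes ([quarter_turnP], [reflectionP]).

    What remains is a finite computation: a signed permutation acts on the six
    pairs (axis, sign) that name the faces, and evaluating the cycles and return
    maps of the 48 elements gives the monomials of the formula ([table]). *)

(** * Tilings fixed by one group element *)

Section TilingsOfCycles.
Variables (aT : finGroupType) (F T : finType) (toF : {action aT &-> F}).
Variable D : tile_designs T toF.
Implicit Types (g h a : aT) (S : F) (tau : {ffun F -> T}).
Local Notation actT := (tiling_action D).
Local Open Scope group_scope.

Lemma num_fixed1 S : num_fixed D S 1 = #|T|.
Proof. by apply: eq_card => t; rewrite !inE act1 eqxx. Qed.

Lemma leq_num_fixedJ S h a : num_fixed D S h <= num_fixed D (toF S a) (h ^ a).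
Proof.
pose m t := (D (t, S) a).1.
have mE t : (m t, toF S a) = D (t, S) a.
  by rewrite [RHS]surjective_pairing design_action2.
have m_inj : injective m.
  by move=> t t' mtt'; have := mE t; rewrite mtt' mE => /act_inj[].
rewrite /num_fixed -(card_imset _ m_inj); apply: subset_leq_card.
apply/subsetP=> _ /imsetP[t /[!inE]/eqP ht ->].
by rewrite mE -actM -conjgC actM ht.
Qed.

Lemma num_fixedJ S h a : num_fixed D (toF S a) (h ^ a) = num_fixed D S h.
Proof.
apply/eqP; rewrite eqn_leq leq_num_fixedJ andbT.
by have := leq_num_fixedJ (toF S a) (h ^ a) a^-1; rewrite actK conjgK.
Qed.

(** The bijection says that the faces [x i] represent the cycles of g, each
    exactly once, and that the cycle of [x i] has length [n i].  A choice of tiles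
    at the representatives, each fixed by its return map, spreads along the cycles
    to exactly one g-invariant tiling. *)
Lemma card_fixed_tilings (I : finType) (x : I -> F) (n : I -> nat) g :
    (forall i, 0 < n i)%N -> (forall i, toF (x i) (g ^+ n i) = x i) ->
    bijective (fun c : {i : I & 'I_(n i)} => toF (x (tag c)) (g ^+ tagged c)) ->
  #|'Fix_actT[g]| = (\prod_i num_fixed D (x i) (g ^+ n i)%g)%N.
Proof.
move=> n_gt0 xn [idx idxK Kidx].
pose P i := [pred t | D (t, x i) (g ^+ n i) == (t, x i)].
have -> : (\prod_i num_fixed D (x i) (g ^+ n i)%g)%N = #|family P|.
  rewrite card_family foldrE big_image; apply: eq_bigr => i _.
  by apply: eq_card => t; rewrite !inE.
pose restr tau : {ffun I -> T} := [ffun i => tau (x i)].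
have fixX tau k S : tau \in 'Fix_actT[g] ->
    (tau (toF S (g ^+ k)%g), toF S (g ^+ k)) = D (tau S, S) (g ^+ k).
  move=> /afix1P tau_g; rewrite -move_tilingE; congr (fun_of_fin _ _, _).
  rewrite -[RHS]/(actT tau (g ^+ k)).
  by elim: k => [|k IHk]; rewrite ?act1 // expgSr actM -IHk tau_g.
rewrite -(card_in_imset (f := restr)) => [|tau tau' Ftau Ftau' eq_restr].
  apply: eq_card => phi; apply/imsetP/familyP => [[tau Ftau ->] i|phiP].
    by rewrite !inE ffunE -fixX // xn.
  pose ext := [ffun S => let c := idx S in
    (D (phi (tag c), x (tag c)) (g ^+ tagged c)).1].
  have idxE i (k : 'I_(n i)) : idx (toF (x i) (g ^+ k)) = Tagged _ k.
    exact: (idxK (Tagged _ k)).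
  have ext_lt i (k : 'I_(n i)) :
      (ext (toF (x i) (g ^+ k)), toF (x i) (g ^+ k)) = D (phi i, x i) (g ^+ k).
    by rewrite [RHS]surjective_pairing design_action2 ffunE idxE.
  have ext_x i : ext (x i) = phi i.
    by have := ext_lt i (Ordinal (n_gt0 i)); rewrite !act1 => -[].
  (* At k = n i the cycle closes up; this is where the constraint on phi i enters. *)
  have ext_le i k : k <= n i ->
      (ext (toF (x i) (g ^+ k)), toF (x i) (g ^+ k)) = D (phi i, x i) (g ^+ k).
    rewrite leq_eqVlt => /predU1P[->|lt_k_n]; last exact: (ext_lt i (Ordinal lt_k_n)).
    by have /eqP-> := phiP i; rewrite xn ext_x.
  exists ext.
    apply/afix1P/esym/move_tilingP=> S; rewrite -(Kidx S); case: (idx S) => i k /=.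
    by rewrite ext_lt -!actM -expgSr ext_le.
  by apply/ffunP=> i; rewrite ffunE ext_x.
apply/ffunP=> S; rewrite -(Kidx S); case: (idx S) => i k /=.
have := fixX _ k (x i) Ftau; have := fixX _ k (x i) Ftau'.
by move/ffunP/(_ i): eq_restr; rewrite !ffunE => -> <- [].
Qed.

Lemma num_tilings_Burnside :
  (\sum_g #|'Fix_actT[g]| = num_tilings D * #|aT|)%N.
Proof.
have actsT : [acts [set: aT], on [set: {ffun F -> T}] | tiling_action D].
  by apply/actsP=> g _ tau; rewrite !inE.
rewrite /num_tilings -[#|aT|]cardsT -(Frobenius_Cauchy actsT).
by apply: eq_big => [g|g _]; rewrite ?inE ?setTI.
Qed.

End TilingsOfCycles.

(** * Signed permutations and the faces of the cube *)

Section FiniteBijections.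
Variables (aT rT : finType) (h : aT -> rT).

Lemma surj_card_bij : (forall y, exists x, y = h x) -> #|aT| = #|rT| -> bijective h.
Proof.
move=> h_surj eq_aT_rT; apply: inj_card_bij; last by rewrite eq_aT_rT.
have /image_injP h_inj : #|image h aT| == #|aT|.
  by rewrite eq_aT_rT; apply/eqP; apply: eq_card => y; have [x ->] := h_surj y; rewrite codom_f.
by move=> x y; apply: h_inj.
Qed.

Lemma inj_surj_bij : injective h -> (forall y, exists x, y = h x) -> bijective h.
Proof.
move=> h_inj h_surj; apply: surj_card_bij => //.
by rewrite -(card_codom h_inj); apply: eq_card => y; have [x ->] := h_surj y; rewrite codom_f.
Qed.

End FiniteBijections.

Section Coordinates.
Variable R : realType.
Implicit Types (s : 'S_3) (e : {ffun 'I_3 -> bool}) (A B : Oh R) (x : 'rV[R]_3).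
Implicit Types (p : 'I_3 * bool).
Local Open Scope ring_scope.

Lemma is_signed_perm_mx s e : is_signed_perm (signed_perm_mx R s e).
Proof. by apply/is_signed_permP; exists s, e. Qed.

Definition signed_perm s e : Oh R := MkOh (is_signed_perm_mx s e).

Lemma signed_permP A : exists s e, A = signed_perm s e.
Proof.
by have /is_signed_permP[s [e Ase]] := Oh_mxP A; exists s, e; apply: val_inj.
Qed.

Lemma signed_permM s e s' e' :
  (signed_perm s e * signed_perm s' e')%g =
  signed_perm (s * s')%g [ffun i => e i (+) e' (s i)].
Proof. by apply: val_inj; rewrite /= mul_signed_perm_mx. Qed.

Lemma signed_perm_inj s e s' e' :
  signed_perm s e = signed_perm s' e' -> s = s' /\ e = e'.
Proof.
move=> /(congr1 val)/matrixP eq_se.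
have {}eq_se i : s i = s' i /\ e i = e' i.
  have := eq_se i (s i); rewrite !mxE eqxx eq_sym mulr1n.
  case: eqP => [<-|_ /eqP]; last by rewrite signr_eq0.
  by move=> /signr_inj ->.
by split; [apply/permP | apply/ffunP] => i; case: (eq_se i).
Qed.

Lemma mulmx_signed_perm x s e i :
  (x *m signed_perm s e) 0 (s i) = (-1) ^+ e i * x 0 i.
Proof.
rewrite mxE (bigD1 i) //= big1 => [|j jNi]; last first.
  by rewrite mxE (inj_eq perm_inj) (negPf jNi) mulr0.
by rewrite mxE eqxx addr0 mulrC.
Qed.

Definition side_set p : classical_sets.set 'rV[R]_3 :=
  classical_sets.setI (cube (R := R)) (fun x => x 0 p.1 = (-1) ^+ p.2).

Lemma is_face_side p : is_face (cube (R := R)) (side_set p).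
Proof.
case: p => i b; exists ((-1) ^+ b *: delta_mx 0 i), 1.
have dotE x : dot x ((-1) ^+ b *: delta_mx 0 i) = (-1) ^+ b * x 0 i.
  rewrite dotE (bigD1 i) //= big1 => [|j jNi]; last first.
    by rewrite !mxE (negPf jNi) !mulr0.
  by rewrite !mxE !eqxx mulr1 mulrC addr0.
split.
- apply/eqP => /rowP/(_ i)/eqP.
  by rewrite !mxE !eqxx mulr1 signr_eq0.
- move=> x cx; rewrite dotE (le_trans (ler_norm _)) // normrM normrX normrN1 expr1n mul1r.
  exact: cube_coord.
- congr (classical_sets.setI _ _); apply/boolp.funext => x /=; apply/boolp.propext.
  rewrite dotE; split => [-> | xi]; first by rewrite -expr2 sqrr_sign.
  by rewrite -[LHS](signrMK b) xi mulr1.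
(* Three vertices of the side: one with all other signs positive, and its two
   neighbours on the side. *)
pose v (c : 'I_3 -> bool) : 'rV[R]_3 := \row_l (-1) ^+ c l.
pose c (o : option 'I_3) l := if l == i then b else Some l == o.
have Fv o : side_set (i, b) (v (c o)).
  by split; [apply: cube_vertex | rewrite mxE /c eqxx].
have vB j : j != i -> v (c (Some j)) - v (c None) = -2 *: delta_mx 0 j.
  move=> jNi; apply/rowP=> l; rewrite !mxE /c.
  have [->|lNi] := eqVneq l i; first by rewrite subrr eq_sym (negPf jNi) mulr0.
  rewrite -[Some l == Some j]/(l == j) -[Some l == None]/false.
  by case: (l == j); rewrite ?subrr ?mulr0 // expr1 expr0 mulr1 -opprD.
have j_i : i + 1 != i. by rewrite -subr_eq0 addrAC subrr.
have k_i : i + 2 != i. by rewrite -subr_eq0 addrAC subrr.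
have j_k : i + 1 != i + 2 :> 'I_3. by rewrite (inj_eq (addrI i)).
exists (v (c None)), (v (c (Some (i + 1)))), (v (c (Some (i + 2)))); split => //.
rewrite !vB //; apply/row_freeP.
exists (- 2^-1 *: (row_mx (delta_mx (i + 1) 0) (delta_mx (i + 2) 0))).
rewrite -scale_col_mx -scalemxAl -scalemxAr scalerA mulrNN divff ?pnatr_eq0 // scale1r.
rewrite mul_col_row !mul_delta_mx_cond !eqxx (negPf j_k) eq_sym (negPf j_k).
rewrite !mulr1n !mulr0n scalar_mx_block.
by have -> : delta_mx 0 0 = 1%:M :> 'M[R]_1 by apply/matrixP=> l m; rewrite !ord1 !mxE.
Qed.

Definition side p : face R := MkFace (boolp.asboolT (is_face_side p)).

(** The action of a signed permutation on the names (axis, sign) of the sides.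
    Arbitrary functions are accepted in place of a permutation and a finite
    function, so that this can be evaluated. *)
Definition turn (f : 'I_3 -> 'I_3) (e : 'I_3 -> bool) p := (f p.1, p.2 (+) e p.1).

Lemma sideP x p : face_set (side p) x <-> cube x /\ x 0 p.1 = (-1) ^+ p.2.
Proof. by []. Qed.

Lemma side_inj : injective side.
Proof.
move=> [i b] [j c] /(congr1 (@face_set R)) eq_side.
pose x : 'rV[R]_3 := \row_l (-1) ^+ (if l == i then b else ~~ c).
have : face_set (side (i, b)) x by split; [apply: cube_vertex | rewrite mxE eqxx].
rewrite /= in eq_side *; rewrite eq_side => -[_]; rewrite mxE => /signr_inj /=.
by case: eqP => [-> ->|_]; last case: (c).
Qed.

Lemma side_surj (F : face R) : exists p, F = side p.
Proof.
have [i [b Fib]] := is_face_cube (boolp.asboolW (faceP F)).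
by exists (i, b); apply: val_inj.
Qed.

(** Comparing the images of two vertices of the side that agree only on the axis
    p.1 shows which axis the image is orthogonal to. *)
Lemma move_side s e p : face_action R (side p) (signed_perm s e) = side (turn s e p).
Proof.
have [[j c] Fj] := side_surj (face_action R (side p) (signed_perm s e)).
rewrite Fj; congr side; case: p Fj => i b Fj.
pose x d : 'rV[R]_3 := \row_l (-1) ^+ (if l == i then b else d).
have /= xj d : (x d *m signed_perm s e) 0 j = (-1) ^+ c.
  have /sideP[//] : face_set (side (j, c)) (x d *m signed_perm s e).
  by rewrite -Fj; exists (x d) => //; split; [apply: cube_vertex | rewrite mxE eqxx].
pose l := (s^-1)%g j; have jE : j = s l by rewrite permKV.
have {}xj d : e l (+) (if l == i then b else d) = c.
  by have := xj d; rewrite jE mulmx_signed_perm mxE -signr_addb => /signr_inj.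
have li : l = i.
  have [//|/negPf lNi] := eqVneq l i.
  by have := xj true; rewrite -(xj false) lNi; case: (e l).
by rewrite /turn /= jE -(xj true) li eqxx addbC.
Qed.

Lemma signed_perm_faithful A B :
  (forall i, face_action R (side (i, false)) A = face_action R (side (i, false)) B) -> A = B.
Proof.
have [s [e ->]] := signed_permP A; have [s' [e' ->]] := signed_permP B => eqAB.
have {}eqAB i : s i = s' i /\ e i = e' i.
  by have := eqAB i; rewrite !move_side => /side_inj[].
by congr signed_perm; [apply/permP | apply/ffunP] => i; case: (eqAB i).
Qed.

Lemma card_face : #|{: face R}| = 6%N.
Proof.
have <- : #|{: 'I_3 * bool}| = 6%N by rewrite card_prod card_ord card_bool.
apply/esym/(@bij_eq_card _ _ side)/inj_surj_bij; [exact: side_inj | exact: side_surj].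
Qed.

Lemma signed_perm_bij : bijective (fun q : 'S_3 * {ffun 'I_3 -> bool} => signed_perm q.1 q.2).
Proof.
apply: inj_surj_bij => [[s e] [s' e'] /signed_perm_inj[/= -> ->] //|A].
by have [s [e ->]] := signed_permP A; exists (s, e).
Qed.

Lemma card_Oh : #|{: Oh R}| = 48%N.
Proof.
by rewrite -(bij_eq_card signed_perm_bij) card_prod card_Sn card_ffun card_bool card_ord.
Qed.

(** The two components of a power are read off from the iterated images of the
    three positive sides. *)
Lemma signed_permX s e n : exists s' e', (signed_perm s e ^+ n)%g = signed_perm s' e' /\
  forall i, (s' i, e' i) = iter n (turn s e) (i, false).
Proof.
elim: n => [|n [s' [e' [IH1 IH2]]]].
  exists 1%g, [ffun=> false]; split=> [|i]; last by rewrite perm1 ffunE.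
  by apply: val_inj; rewrite /= signed_perm_mx1.
do 2!eexists; split; first by rewrite expgSr IH1 signed_permM.
by move=> i; rewrite iterS -IH2 permM ffunE.
Qed.

End Coordinates.

(** * Symmetry classes *)

(** The conjugacy classes of the dihedral group of a square, [Reflection] being
    the class of the reflections whose mirror contains no vertex. *)
Inductive symmetry := Id | Quarter | Half | Reflection | Diagonal.

(** An explicit list, since the enumeration of a finite type does not evaluate. *)
Definition axes : seq 'I_3 :=
  [:: @Ordinal 3 0 isT; @Ordinal 3 1 isT; @Ordinal 3 2 isT].

Lemma mem_axes i : i \in axes.
Proof. by case: i => -[|[|[|[]]]] lti; rewrite /axes ?inE. Qed.

Definition parity (e : 'I_3 -> bool) := foldr addb false (map e axes).

(** The symmetry class of a signed permutation that preserves a face.  Such a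
    permutation fixes one axis without changing its sign, and permutes or negates
    the other two: exchanging them gives a quarter turn or a diagonal reflection,
    keeping them gives the identity, a half turn or a reflection.  On other
    signed permutations the value is meaningless. *)
Definition classify (f : 'I_3 -> 'I_3) (e : 'I_3 -> bool) :=
  if all (fun i => f i == i) axes then
    if parity e then Reflection else if ~~ has e axes then Id else Half
  else if parity e then Quarter else Diagonal.

Section Classes.
Variable R : realType.
Implicit Types (s : 'S_3) (e : {ffun 'I_3 -> bool}) (A B : Oh R).
Local Open Scope group_scope.

Lemma parityE (e : 'I_3 -> bool) : parity e = \big[addb/false]_i e i.
Proof.
rewrite !big_ord_recl big_ord0 /parity /=.
by congr (e _ (+) (e _ (+) (e _ (+) _))); apply: val_inj.
Qed.

Lemma signed_perm1 : 1 = signed_perm R 1 [ffun=> false].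
Proof. by apply: val_inj; rewrite /= signed_perm_mx1. Qed.

Definition axes_perm A := (Oh_code A).1.
Definition sign_parity A := parity (Oh_code A).2.

Lemma Oh_code_signed_perm s e : Oh_code (signed_perm R s e) = (s, e).
Proof.
rewrite /Oh_code; case: pickP => [[s' e'] /eqP/= seE|/(_ (s, e))]; last by rewrite eqxx.
by case: (@signed_perm_inj R s e s' e') => [|-> ->]; first exact: val_inj.
Qed.

Lemma axes_permM : {morph axes_perm : A B / A * B}.
Proof.
move=> A B; have [s [e ->]] := signed_permP A; have [s' [e' ->]] := signed_permP B.
by rewrite signed_permM /axes_perm !Oh_code_signed_perm.
Qed.

Lemma sign_parityM : {morph sign_parity : A B / A * B >-> A (+) B}.
Proof.
move=> A B; have [s [e ->]] := signed_permP A; have [s' [e' ->]] := signed_permP B.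
rewrite signed_permM /sign_parity !Oh_code_signed_perm /= !parityE.
rewrite [X in _ (+) X](reindex_inj (@perm_inj _ s)) -big_split.
by apply: eq_bigr => i _; rewrite ffunE.
Qed.

Lemma axes_permJ A B : axes_perm (A ^ B) = axes_perm A ^ axes_perm B.
Proof. by apply/(mulgI (axes_perm B)); rewrite -axes_permM -!conjgC axes_permM. Qed.

Lemma sign_parityJ A B : sign_parity (A ^ B) = sign_parity A.
Proof. by apply/(@addbI (sign_parity B)); rewrite -sign_parityM -conjgC sign_parityM addbC. Qed.

(** [classify] in terms of the two homomorphisms [axes_perm] and [sign_parity],
    which makes its invariance under conjugation evident. *)
Definition symmetry_of A :=
  if axes_perm A == 1 then
    if sign_parity A then Reflection else if A == 1 then Id else Half
  else if sign_parity A then Quarter else Diagonal.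

Lemma symmetry_ofJ A B : symmetry_of (A ^ B) = symmetry_of A.
Proof. by rewrite /symmetry_of axes_permJ sign_parityJ !conjg_eq1. Qed.

Lemma symmetry_of_signed_perm s e : symmetry_of (signed_perm R s e) = classify s e.
Proof.
rewrite /symmetry_of /classify /axes_perm /sign_parity Oh_code_signed_perm.
rewrite -[(s, e).1]/s -[(s, e).2]/e.
have -> : all (fun i => s i == i) axes = (s == 1).
  apply/allP/eqP => [s1|-> i _]; last by rewrite perm1.
  by apply/permP=> i; rewrite perm1; apply/eqP/s1/mem_axes.
case: eqP => // s1; rewrite s1 -[X in if X then Id else _]negbK.
have <- // : has e axes = (signed_perm R 1 e != 1).
rewrite signed_perm1; apply/idP/idP => [/hasP[i _ ei]|].
  by apply: contraTneq ei => /signed_perm_inj[_ ->]; rewrite ffunE.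
apply: contra_neqT => /hasPn noe; congr signed_perm; apply/ffunP=> i; rewrite ffunE.
by apply/negbTE/noe/mem_axes.
Qed.

Lemma eq_classify (f f' : 'I_3 -> 'I_3) (e e' : 'I_3 -> bool) :
  f =1 f' -> e =1 e' -> classify f e = classify f' e'.
Proof.
move=> ff' ee'; rewrite /classify /parity (eq_map ee') (eq_has ee').
by rewrite (@eq_all _ _ (fun i => f' i == i)) // => i; rewrite ff'.
Qed.

End Classes.

(** * Face stabilizers up to conjugacy *)

Local Notation i0 := (@Ordinal 3 0 isT).
Local Notation i1 := (@Ordinal 3 1 isT).
Local Notation i2 := (@Ordinal 3 2 isT).

Lemma ord3_ind (P : 'I_3 -> Prop) : P i0 -> P i1 -> P i2 -> forall i, P i.
Proof. by move=> P0 P1 P2 i; have := mem_axes i; rewrite !inE => /or3P[]/eqP->. Qed.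

Section NormalForm.
Variable R : realType.
Implicit Types (s : 'S_3) (e : {ffun 'I_3 -> bool}) (A B h : Oh R) (k : symmetry).
Local Open Scope group_scope.
Local Notation faces := (face_action R).

Definition front : face R := side R (i0, false).

Definition representative k : Oh R :=
  signed_perm R (if k is (Quarter | Diagonal) then tperm i1 i2 else 1)
    [ffun i => match k with
               | Quarter | Reflection => i == i2
               | Half => i != i0
               | Id | Diagonal => false
               end].

Definition swap : Oh R := signed_perm R (tperm i1 i2) [ffun=> false].
Definition flip : Oh R := signed_perm R 1 [ffun i => i == i1].

(** Among the eight elements of the stabilizer, conjugation by [swap] exchanges
    the two reflections and the two quarter turns, and conjugation by [flip] the
    two diagonal reflections. *)
Lemma front_normal_form h : h \in 'C[front | faces] ->
  exists B, B \in 'C[front | faces] /\ h = representative (symmetry_of h) ^ B.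
Proof.
have [s [e ->]] := signed_permP h; rewrite symmetry_of_signed_perm.
move/astab1P; rewrite move_side => /side_inj[s0 e0].
have t0 : tperm i1 i2 i0 = i0 by rewrite tpermD.
have conj B : representative (classify s e) * B = B * signed_perm R s e ->
    signed_perm R s e = representative (classify s e) ^ B.
  by move=> rB; rewrite /conjg rB mulKg.
have s12 : (s i1, s i2) = (i1, i2) \/ (s i1, s i2) = (i2, i1).
  have : uniq [:: s i0; s i1; s i2].
    by rewrite -[X in uniq X]/(map s axes) map_inj_uniq //; apply: perm_inj.
  rewrite s0; elim/ord3_ind: (s i1); elim/ord3_ind: (s i2) => //; by [left | right].
have [C1 Cs Cf] : [/\ (1 : Oh R) \in 'C[front | faces], swap \in 'C[front | faces]
                    & flip \in 'C[front | faces]].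
  by split; apply/astab1P; rewrite ?act1 // move_side /turn /= ?t0 ?perm1 !ffunE.
exists (match classify s e with
  | Id | Half => 1
  | Quarter | Reflection => if e i2 then 1 else swap
  | Diagonal => if e i2 then flip else 1 end).
split; first by case: classify; case: (e i2).
apply: conj; apply: signed_perm_faithful.
case e1: (e i1); case e2: (e i2); case: s12 => -[s1 s2];
  rewrite /classify /parity /= s0 s1 s2 e0 e1 e2 /=;
  elim/ord3_ind; rewrite !actM ?act1 !move_side; congr side;
  by rewrite /turn /= ?(perm1, t0, tpermL, tpermR, ffunE, s0, s1, s2, e0, e1, e2).
Qed.

(** Transitivity on the faces reduces this to the stabilizer of [front].  It
    turns later questions on face stabilizers into questions on five matrices. *)
Lemma stabilizer_normal_form (S : face R) h : h \in 'C[S | faces] ->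
  exists A, S = faces front A /\ h = representative (symmetry_of h) ^ A.
Proof.
have [[i b] ->] := side_surj S => /astab1P hS.
pose A := signed_perm R (tperm i0 i) [ffun=> b].
have AS : side R (i, b) = faces front A by rewrite move_side /turn /= tpermL ffunE.
have : h ^ A^-1 \in 'C[front | faces].
  by apply/astab1P; rewrite /conjg invgK !actM -AS hS AS actK.
move=> /front_normal_form[B [/astab1P BS hB]]; exists (B * A); split.
  by rewrite actM BS.
by rewrite conjgM -[h in RHS](conjgKV A) symmetry_ofJ -hB conjgKV.
Qed.

(** This is what makes the numbers t_g depend only on the class of g, and not on
    the face. *)
Lemma num_fixed_symmetry (T : finType) (D : tile_designs T faces) (S S' : face R) h h' :
    h \in 'C[S | faces] -> h' \in 'C[S' | faces] -> symmetry_of h = symmetry_of h' ->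
  num_fixed D S h = num_fixed D S' h'.
Proof.
move=> /stabilizer_normal_form[A [SA hA]] /stabilizer_normal_form[A' [SA' hA']] hh'.
by rewrite SA SA' hA hA' !num_fixedJ hh'.
Qed.

Lemma symmetry_of_representative k : symmetry_of (representative k) = k.
Proof.
have t0 : tperm i1 i2 i0 = i0 by rewrite tpermD.
rewrite symmetry_of_signed_perm.
by case: k; rewrite /classify /parity /= ?(perm1, t0, tpermL, ffunE).
Qed.

Lemma symmetry_of_representative_sqr k :
  symmetry_of (representative k ^+ 2) = if k is Quarter then Half else Id.
Proof.
have t0 : tperm i1 i2 i0 = i0 by rewrite tpermD.
rewrite expgS expg1 signed_permM symmetry_of_signed_perm.
by case: k; rewrite /classify /parity /= ?(permM, perm1, t0, tpermL, tpermR, ffunE).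
Qed.

End NormalForm.

(** * Recognizing the geometric symmetries *)

Section GeometricSymmetries.
Variable R : realType.
Implicit Types (A h : Oh R) (F : face R) (x u v c : 'rV[R]_3).
Local Open Scope ring_scope.
Local Notation faces := (face_action R).

Lemma face_not_collinear F c v : ~ (forall x, face_set F x -> exists b, x = c + b *: v).
Proof.
have [_ [_ [_ _ _ [p [q [s [Fp Fq Fs /eqP rk2]]]]]]] := boolp.asboolW (faceP F).
move=> line; have [b pE] := line _ Fp; have [b' qE] := line _ Fq; have [b'' sE] := line _ Fs.
suff dirE : col_mx (q - p) (s - p) = col_mx (b' - b)%:M (b'' - b)%:M *m v.
  by have := mulmx_max_rank (col_mx (b' - b)%:M (b'' - b)%:M) v; rewrite -dirE rk2.
have diffE t t' : c + t *: v - (c + t' *: v) = (t - t') *: v.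
  by rewrite opprD addrACA subrr add0r scalerBl.
by rewrite mul_col_mx !mul_scalar_mx pE qE sE !diffE.
Qed.

Lemma stabilizer_face F h x : h \in 'C[F | faces]%g -> face_set F x -> face_set F (x *m h).
Proof. by move=> /astab1P FhF Fx; rewrite -FhF; exists x. Qed.

Lemma mulmx_conj A h x : x *m A *m (h ^ A)%g = x *m h *m A.
Proof. by rewrite -!mulmxA -!Oh_mxM -conjgC. Qed.

Lemma symmetry_of_sqr F h : h \in 'C[F | faces]%g ->
  symmetry_of (h ^+ 2)%g = if symmetry_of h is Quarter then Half else Id.
Proof.
move=> /stabilizer_normal_form[A [_ hE]].
rewrite {1}hE -conjXg symmetry_ofJ.
exact: symmetry_of_representative_sqr.
Qed.

Lemma symmetry_of_Id h : symmetry_of h = Id -> h = 1%g.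
Proof. by rewrite /symmetry_of; do 3!case: ifP => //; move=> /eqP. Qed.

Lemma oppr_fixed0 x : - x = x -> x = 0.
Proof.
move=> /esym/eqP; rewrite -addr_eq0 -mulr2n -scaler_nat scaler_eq0 pnatr_eq0 /=.
by move/eqP.
Qed.

(** Among the classes only [Quarter] has a nontrivial square, so it suffices that
    r ^+ 2 is not the identity.  As r acts on the plane of F by a quarter turn
    about c, its square would otherwise force every point of F to equal c. *)
Lemma quarter_turnP F r : quarter_turn F r -> r \in 'C[F | faces]%g /\ symmetry_of r = Quarter.
Proof.
case=> rF [c [u [v [[_ _ _ frameE] rE]]]]; split=> //.
suff : symmetry_of (r ^+ 2)%g <> Id by rewrite (symmetry_of_sqr rF); case: symmetry_of.
move=> /symmetry_of_Id r2; apply: (@face_not_collinear F c 0) => x Fx; exists 0.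
have [a [b xE]] := frameE x Fx; rewrite scaler0 addr0.
have rr : (r * r)%g = 1%g by rewrite -r2 expgS expg1.
have x_fix : x *m r *m r = x by rewrite -mulmxA -Oh_mxM rr Oh_mx1 mulmx1.
have xrE : x *m r = c + - b *: u + a *: v by rewrite xE rE -?xE // -scaleNr.
have := stabilizer_face rF Fx; rewrite xrE => /rE; rewrite -xrE x_fix scaleNr => xrrE.
rewrite xE -addrA (@oppr_fixed0 (a *: u + b *: v)) ?addr0 //.
by apply: (@addrI _ c); rewrite opprD !addrA -xE xrrE.
Qed.

Lemma halfE x c : x + x = c -> x = 2^-1 *: c.
Proof. by move=> <-; rewrite -mulr2n -scaler_nat scalerK ?pnatr_eq0. Qed.

(** Here m is twice the centre of the face, which for the side of the first axis is
    twice the first unit vector. *)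
Lemma half_turnE F h : h \in 'C[F | faces]%g -> symmetry_of h = Half ->
  exists m, forall z, face_set F z -> z *m h = m - z.
Proof.
move=> /stabilizer_normal_form[A [-> hA]] hk; rewrite hk in hA.
exists (2 *: delta_mx 0 (@Ordinal 3 0 isT) *m A) => _ [x [_ /= x0] <-].
rewrite hA mulmx_conj -mulmxBl; congr (_ *m _); apply/rowP=> i.
rewrite -{1}(perm1 i) mulmx_signed_perm ffunE !mxE eqxx /=.
have [->|_] := eqVneq i; first by rewrite x0 !mul1r mulr1 -[2]/(1 + 1) addrK.
by rewrite mulN1r mulr0 sub0r.
Qed.

(** The other classes are excluded one by one.  The points of F fixed by f lie on
    the mirror; the identity would place all of F there, and a diagonal reflection
    a vertex.  For a half turn the midpoint of z and z f is the centre of F; but this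
    midpoint is the projection of z to the mirror, so F would be contained in a line
    parallel to v.  Finally f is an involution on F, which a quarter turn is
    not. *)
Lemma reflectionP F f :
  nondiagonal_reflection F f -> f \in 'C[F | faces]%g /\ symmetry_of f = Reflection.
Proof.
case=> fF [c [u [v [[_ _ _ frameE] fE no_vertex]]]]; split=> //.
have zE z : face_set F z -> exists a b, z = c + a *: u + b *: v /\ z *m f = c + a *: u - b *: v.
  by move=> Fz; have [a [b zE]] := frameE z Fz; exists a, b; rewrite {2}zE fE -?zE.
have fixE z : face_set F z -> z *m f = z -> exists a, z = c + a *: u.
  move=> /zE[a [b [-> ->]]] /addrI/oppr_fixed0 ->; exists a; by rewrite addr0.
(* A vertex on the mirror of the representative of Diagonal. *)
pose one : 'rV[R]_3 := \row_i (-1) ^+ false.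
have front_one : face_set (front R) one by split; [exact: cube_vertex | rewrite mxE].
have [A [FA fA]] := stabilizer_normal_form fF.
have Fone : face_set F (one *m A) by rewrite FA; exists one.
case fk: (symmetry_of f) => //; rewrite fk in fA.
- case: (@face_not_collinear F c u) => z Fz; apply: fixE => //.
  by rewrite (symmetry_of_Id fk) mulmx1.
- have f2F : (f ^+ 2)%g \in 'C[F | faces]%g by apply: groupX.
  have [m mE] : exists m, forall z, face_set F z -> z *m (f ^+ 2)%g = m - z.
    by apply: half_turnE => //; rewrite (symmetry_of_sqr fF) fk.
  case: (@face_not_collinear F (2^-1 *: m) 0) => z Fz; exists 0.
  rewrite scaler0 addr0; apply: halfE; rewrite -(subrK z m) -mE //; congr (_ + _).
  have ff : (f ^+ 2)%g = (f * f)%g by rewrite expgS expg1.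
  rewrite ff Oh_mxM mulmxA; have [a [b [zab zfE]]] := zE z Fz.
  have := stabilizer_face fF Fz; rewrite zfE -scaleNr => /fE ->.
  by rewrite scaleNr opprK.
- have [m mE] := half_turnE fF fk.
  case: (@face_not_collinear F (2^-1 *: m) v) => z Fz.
  have [a [b [zab zfE]]] := zE z Fz; exists b; rewrite zab; congr (_ + _); apply: halfE.
  rewrite -(subrK z m) -mE // zfE zab.
  by rewrite [RHS]addrACA addNr addr0.
- case: (no_vertex (one *m A)) => //.
    by exists A => //; congr (_ *m _); apply/rowP=> i; rewrite !mxE.
  apply: fixE => //; rewrite fA mulmx_conj; congr (_ *m _).
  apply/rowP=> i; rewrite -(permKV (tperm (@Ordinal 3 1 isT) (@Ordinal 3 2 isT)) i).
  by rewrite mulmx_signed_perm !mxE ffunE mul1r.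
Qed.

End GeometricSymmetries.

(** * Evaluating the cycles of the 48 elements *)

Definition sides : seq ('I_3 * bool) := [seq (i, b) | i <- axes, b <- [:: false; true]].

(** Pairs of a representative and the length of its cycle; the representative is
    the first member of its orbit in [sides].  Six steps exhaust any orbit. *)
Definition cycles (f : 'I_3 -> 'I_3) (e : 'I_3 -> bool) : seq (('I_3 * bool) * nat) :=
  let orbit p := undup (traject (turn f e) p 6) in
  [seq (p, size (orbit p)) | p <- sides
     & all (fun q => index p sides <= index q sides) (orbit p)].

(** The conditions are chosen to be checked by evaluation.  Covering all sides with
    total length 6 replaces the disjointness of the cycles. *)
Definition is_cycle_decomposition f e (cs : seq (('I_3 * bool) * nat)) :=
  [&& all (fun c => (0 < c.2) && (iter c.2 (turn f e) c.1 == c.1)) cs,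
      all (fun p => has (fun c => has (fun k => iter k (turn f e) c.1 == p) (iota 0 c.2)) cs)
        sides
    & sumn (map snd cs) == 6].

(** The class of the n-th power of a signed permutation, see [signed_permX]. *)
Definition symmetry_pow f e n :=
  classify (fun i => (iter n (turn f e) (i, false)).1)
           (fun i => (iter n (turn f e) (i, false)).2).

Definition cycle_type f e := [seq symmetry_pow f e c.2 | c <- cycles f e].

(** Turns a list indexed by the three axes into a function that evaluates, unlike
    a permutation or a finite function. *)
Definition entry {A : Type} (a0 : A) (l : seq A) (i : 'I_3) : A := nth a0 l i.

Lemma entry_map {A : Type} (a0 : A) (f : 'I_3 -> A) : entry a0 (map f axes) = f.
Proof. by apply: boolp.funext; elim/ord3_ind. Qed.

Definition axes_lists : seq (seq 'I_3) := permutations axes.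
Definition sign_lists : seq (seq bool) :=
  [seq a :: l | a <- [:: false; true],
                l <- [seq [:: b; c] | b <- [:: false; true], c <- [:: false; true]]].

(** One entry for each element of O_h: the classes of the return maps of its
    cycles on the faces, so that each entry is a monomial of the formula. *)
Definition table : seq (seq symmetry) :=
  [seq cycle_type (entry i0 l) (entry false b) | l <- axes_lists, b <- sign_lists].

Lemma table_cycles : all (fun l => all (fun b =>
    is_cycle_decomposition (entry i0 l) (entry false b) (cycles (entry i0 l) (entry false b)))
  sign_lists) axes_lists.
Proof. by vm_compute. Qed.

Lemma perm_axes_lists : perm_eq [seq map s axes | s : 'S_3] axes_lists.
Proof.
have inj_map : injective (fun s : 'S_3 => map s axes).
  by move=> s s' eq_ss'; apply/permP=> i; rewrite -(entry_map i0 s) eq_ss' entry_map.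
have uniq_map : uniq [seq map s axes | s : 'S_3] by rewrite map_inj_uniq ?enum_uniq.
have size_lists : size axes_lists = 6 by vm_compute.
apply: (uniq_perm uniq_map); first exact: permutations_uniq.
suff sub_lists : {subset [seq map s axes | s : 'S_3] <= axes_lists}.
  apply: (uniq_min_size uniq_map sub_lists _).2.
  by rewrite size_lists size_map -cardE card_Sn.
move=> _ /mapP[s _ ->].
rewrite mem_permutations; apply: uniq_perm; rewrite ?(map_inj_uniq (@perm_inj _ s)) //.
by move=> i; rewrite mem_axes -(permKV s i) map_f ?mem_axes.
Qed.

Lemma perm_sign_lists : perm_eq [seq map e axes | e : {ffun 'I_3 -> bool}] sign_lists.
Proof.
have inj_map : injective (fun e : {ffun 'I_3 -> bool} => map e axes).
  by move=> e e' eq_ee'; apply/ffunP=> i; rewrite -(entry_map false e) eq_ee' entry_map.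
have uniq_map : uniq [seq map e axes | e : {ffun 'I_3 -> bool}].
  by rewrite map_inj_uniq ?enum_uniq.
apply: (uniq_perm uniq_map) => //.
suff sub_lists : {subset [seq map e axes | e : {ffun 'I_3 -> bool}] <= sign_lists}.
  apply: (uniq_min_size uniq_map sub_lists _).2.
  by rewrite size_map -cardE card_ffun card_bool card_ord.
by move=> _ /mapP[e _ ->]; rewrite /=; case: (e i0); case: (e i1); case: (e i2).
Qed.

Section Count.
Variables (R : realType) (T : finType) (D : tile_designs T (face_action R)).
Variable w : symmetry -> nat.
Hypothesis num_fixedE : forall (S : face R) (h : Oh R),
  h \in 'C[S | face_action R]%g -> num_fixed D S h = w (symmetry_of h).
Local Notation actT := (tiling_action D).
Implicit Types (s : 'S_3) (e : {ffun 'I_3 -> bool}).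

Lemma iter_move_side s e p n :
  face_action R (side R p) (signed_perm R s e ^+ n)%g = side R (iter n (turn s e) p).
Proof. by elim: n => [|n IHn]; rewrite ?act1 // expgSr actM IHn move_side. Qed.

Lemma symmetry_of_signed_permX s e n :
  symmetry_of (signed_perm R s e ^+ n)%g = symmetry_pow s e n.
Proof.
have [s' [e' [-> seE]]] := signed_permX R s e n.
by rewrite symmetry_of_signed_perm; apply: eq_classify => i; rewrite -seE.
Qed.

Lemma card_fixed_signed_perm s e : is_cycle_decomposition s e (cycles s e) ->
  #|'Fix_actT[signed_perm R s e]%g| = \prod_(k <- cycle_type s e) w k.
Proof.
rewrite /cycle_type; case/and3P; move: (cycles s e) => cs /allP csP /allP cover /eqP size6.
pose x (i : 'I_(size cs)) := (tnth (in_tuple cs) i).1.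
pose n (i : 'I_(size cs)) := (tnth (in_tuple cs) i).2.
have csi i : 0 < n i /\ iter (n i) (turn s e) (x i) = x i.
  by have /andP[n0 /eqP] := csP _ (mem_tnth i (in_tuple cs)).
rewrite (@card_fixed_tilings _ _ _ _ D _ (fun i => side R (x i)) n) => [|i|i|].
- rewrite big_map [RHS]big_tnth; apply: eq_bigr => i _.
  rewrite num_fixedE ?symmetry_of_signed_permX //.
  by apply/astab1P; rewrite iter_move_side; case: (csi i) => _ ->.
- by case: (csi i).
- by rewrite iter_move_side; case: (csi i) => _ ->.
apply: surj_card_bij => [S|].
  have [p ->] := side_surj S.
  have /hasP[c /seq_tnthP[i ->] /hasP[k]] : has (fun c => has (fun k =>
      iter k (turn s e) c.1 == p) (iota 0 c.2)) cs.
    by apply: cover; case: p => i b; apply: allpairs_f; rewrite ?mem_axes //; case: b.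
  rewrite mem_iota add0n => /= ltk /eqP <-.
  by exists (Tagged (fun i => 'I_(n i)) (Ordinal ltk)); rewrite iter_move_side.
rewrite card_tagged card_face -size6 !sumnE !big_map.
rewrite -enumT big_enum [RHS]big_tnth.
by apply: eq_bigr => i _; rewrite card_ord.
Qed.

Lemma num_tilings_table :
  num_tilings D * 48 = \sum_(ks <- table) \prod_(k <- ks) w k.
Proof.
rewrite -(card_Oh R) -num_tilings_Burnside.
have [inv invK Kinv] := signed_perm_bij R.
rewrite (reindex _ (onW_bij _ (signed_perm_bij R))) /=.
rewrite -(pair_big predT predT (fun s e => #|'Fix_actT[signed_perm R s e]%g|)) /=.
rewrite /table big_allpairs_dep -(perm_big _ perm_axes_lists) big_map big_enum.
apply: eq_bigr => s _.
rewrite -(perm_big _ perm_sign_lists) big_map big_enum; apply: eq_bigr => e _.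
rewrite !entry_map; apply: card_fixed_signed_perm.
have sP : map s axes \in axes_lists.
  by rewrite -(perm_mem perm_axes_lists) (map_f (fun s : 'S_3 => map s axes)) ?mem_enum.
have eP : map e axes \in sign_lists.
  rewrite -(perm_mem perm_sign_lists).
  by rewrite (map_f (fun e : {ffun 'I_3 -> bool} => map e axes)) ?mem_enum.
by have /allP/(_ _ eP) := allP table_cycles _ sP; rewrite !entry_map.
Qed.

Lemma sum_table : \sum_(ks <- table) \prod_(k <- ks) w k =
  (w Id ^ 6 + 6 * w Id * w Quarter ^ 2 + 3 * w Id ^ 2 * w Half ^ 2
      + 8 * w Id ^ 2 + 6 * w Id ^ 3 + w Id ^ 3 + 6 * w Id * w Half
      + 3 * w Id * w Reflection ^ 4 + 8 * w Id + 6 * w Id ^ 2 * w Diagonal ^ 2).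
Proof.
let t := eval vm_compute in table in rewrite (_ : table = t); last by vm_compute.
rewrite !big_cons !big_nil.
ring.
Qed.

End Count.

(** In coordinates a quarter turn exchanges two axes and a reflection does not,
    while both change an odd number of signs. *)
Lemma symmetry_ofM_Diagonal (R : realType) (r f : Oh R) :
  symmetry_of r = Quarter -> symmetry_of f = Reflection -> symmetry_of (r * f)%g = Diagonal.
Proof.
rewrite /symmetry_of axes_permM sign_parityM.
case: (axes_perm r =P 1%g) => [_|/eqP/negPf r1]; first by do 2!case: ifP.
case: (sign_parity r) => // _; case: (axes_perm f =P 1%g) => [->|_]; last by case: ifP.
by case: (sign_parity f); rewrite ?mulg1 ?r1 //; case: ifP.
Qed.

Local Open Scope ring_scope.

Theorem theorem5 (R : realType) (T : finType) (D : tile_designs T (face_action R))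
    (F : face R) (r f : Oh R)
    (hr : quarter_turn F r) (hf : nondiagonal_reflection F f)
    (t_id t_r t_r2 t_f t_rf : nat)
    (h_id : t_id = #|T|)
    (h_r : t_r = num_fixed D F r)
    (h_r2 : t_r2 = num_fixed D F (r ^+ 2)%g)
    (h_f : t_f = num_fixed D F f)
    (h_rf : t_rf = num_fixed D F (r * f)%g) :
  (num_tilings D)%:R =
    1 / 48%:R * (t_id ^ 6 + 6 * t_id * t_r ^ 2 + 3 * t_id ^ 2 * t_r2 ^ 2
      + 8 * t_id ^ 2 + 6 * t_id ^ 3 + t_id ^ 3 + 6 * t_id * t_r2
      + 3 * t_id * t_f ^ 4 + 8 * t_id + 6 * t_id ^ 2 * t_rf ^ 2)%N%:R :> rat
  /\
  1 / 48%:R * (t_id ^ 6 + 6 * t_id * t_r ^ 2 + 3 * t_id ^ 2 * t_r2 ^ 2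
      + 8 * t_id ^ 2 + 6 * t_id ^ 3 + t_id ^ 3 + 6 * t_id * t_r2
      + 3 * t_id * t_f ^ 4 + 8 * t_id + 6 * t_id ^ 2 * t_rf ^ 2)%N%:R =
    1 / 48%:R * (t_id ^ 6 + 7 * t_id ^ 3 + 8 * t_id ^ 2 + 8 * t_id
      + 6 * t_id * t_r ^ 2 + 6 * t_id * t_r2 + 3 * t_id ^ 2 * t_r2 ^ 2
      + 3 * t_id * t_f ^ 4 + 6 * t_id ^ 2 * t_rf ^ 2)%N%:R :> rat.
Proof.
split; last by congr (_ * _%:R); ring.
have [rF r_quarter] := quarter_turnP hr; have [fF f_reflection] := reflectionP hf.
have r2F : (r ^+ 2)%g \in 'C[F | face_action R]%g by apply: groupX.
have r2_half : symmetry_of (r ^+ 2)%g = Half by rewrite (symmetry_of_sqr rF) r_quarter.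
have rfF : (r * f)%g \in 'C[F | face_action R]%g by apply: groupM.
have rf_diagonal := symmetry_ofM_Diagonal r_quarter f_reflection.
pose w k := match k with
            | Id => t_id | Quarter => t_r | Half => t_r2 | Reflection => t_f | Diagonal => t_rf
            end.
have num_fixedE (S : face R) (h : Oh R) :
    h \in 'C[S | face_action R]%g -> num_fixed D S h = w (symmetry_of h).
  { move=> hS; case h_sym: (symmetry_of h); first by rewrite (symmetry_of_Id h_sym) num_fixed1.
  all: by rewrite /= ?h_r ?h_r2 ?h_f ?h_rf; apply: num_fixed_symmetry; rewrite ?h_sym. }
have := num_tilings_table num_fixedE; rewrite sum_table => <-.
by rewrite natrM mulrC mul1r mulfK ?pnatr_eq0.
Qed.
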